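(* For every $\alpha\ge1$, AugmentedGreedy has the same size and lightness guarantees as Greedy for the undirected coupled multiplicative $\alpha$-spanner problem. That is, for any class of instances of this problem and any function $g$ of the number $n$ of nodes (and of $\alpha$): if the spanner returned by Greedy has size at most $g$ on all instances in the class, then so does the spanner returned by AugmentedGreedy; and likewise with ''lightness'' in place of ''size''.
   Context: Undirected coupled multiplicative $\alpha$-spanner problem: given a connected simple undirected graph $G=(V,E)$ with $n$ nodes and edge values $w(e)=\ell(e)>0$ (weight equals length for every edge), find a minimum-weight subgraph $H=(V,E')$, $E'\subseteq E$, with $d_H^\ell(u,v)\le\delta(u,v):=\alpha\cdot d_G^\ell(u,v)$ for all node pairs, where $d^\ell$ is shortest-path distance w.r.t. $\ell$. It suffices to enforce the demands for the metric edges $M\subseteq E$, i.e. the edges $e=\{u,v\}$ with $d^\ell_{G-e}(u,v)>\ell(e)$; both algorithms are run with terminal pairs $K=M$ and with the same tie-breaking. The size of $H$ is $|E'|$; its lightness is $w(E')/w(\mathit{MST}(G,w))$, where $w(E')=\sum_{e\in E'}w(e)$ and $\mathit{MST}(G,w)$ is a minimum-weight spanning tree of $G$. Greedy$(G,K,\ell,\delta)$: start with $H=(V,\emptyset)$; process the pairs $(u,v)\in K$ in non-decreasing order of $d_G^\ell(u,v)$; if $d_H^\ell(u,v)>\delta(u,v)$ for the current $H$, add to $H$ the shortest $uv$-path of $G$ w.r.t. $\ell$, where ties are broken consistently so that shortest paths are unique. Return $H$. AugmentedGreedy$(G,K,w,\ell,\delta)$: let $\mathcal W=\{w(e):e\in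 E\}$, $E[w']=\{e\in E:w(e)\le w'\}$, $G[w']=(V,E[w'])$. (1) Determine $\hat w=\min\{w'\in\mathcal W:G[w']\text{ is a feasible spanner}\}$. (2) Set $\hat w\leftarrow\max\{\hat w,w(\mathit{MST}(G,w))\}$. (3) Return Greedy$(G[\hat w],K,\ell,\delta)$ (with $\delta$ unchanged, i.e. defined via distances in the original $G$). *)

(* Defs.v *)
From HB Require Import structures.
From mathcomp Require Import all_boot all_order all_algebra.
From mathcomp Require Import constructive_ereal.

Set Implicit Arguments.
Unset Strict Implicit.
Unset Printing Implicit Defensive.

Import Order.TTheory GRing.Theory Num.Theory.

Local Open Scope ring_scope.

(* An undirected graph on V is given by its set of edges, an edge being an
   unordered pair [set u; v]. All subgraphs below are spanning, i.e. they have
   vertex set V, so they are given by their edge sets as well. *)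
Section Graphs.
Variable V : finType.
Implicit Types (E T P : {set {set V}}) (u v : V) (p c : seq V).

Definition simple_graph E : bool := [forall e in E, #|e| == 2%N].

Definition adj E : rel V := fun u v => [set u; v] \in E.

Definition connected_graph E : bool := [forall u, forall v, connect (adj E) u v].

(* Cycles of length at most 2 merely traverse an edge back and forth. A
   duplicate-free sequence has at most #|V| entries, so the bound on the size of
   c is harmless. *)
Definition acyclic T : bool :=
  [forall c : #|V|.-bseq V, ucycleb (adj T) c ==> (size c <= 2)%N].

Definition spanning_tree E T : bool :=
  [&& T \subset E, connected_graph T & acyclic T].

Definition path_edges u p : {set {set V}} :=
  [set:: pairmap (fun x y => [set x; y]) u p].

(* P is the edge set of a simple path from u to v in the graph E. *)
Definition is_path E u v P : bool :=
  [exists p : #|V|.-bseq V,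
    [&& path (adj E) u p, last u p == v, uniq (u :: p) & P == path_edges u p]].

(* pair_le orders terminal pairs at equal distance; path_le orders paths (as edge
   sets) of equal length. The rule refers to no particular graph, so one rule
   can be used consistently for a graph and for its subgraphs. *)
Record tie_breaking := TieBreaking {
  pair_le : rel (V * V);
  pair_le_total : total pair_le;
  pair_le_trans : transitive pair_le;
  pair_le_anti : antisymmetric pair_le;
  path_le : rel {set {set V}};
  path_le_total : total path_le;
  path_le_trans : transitive path_le;
  path_le_anti : antisymmetric path_le
}.

End Graphs.

Section Algorithms.
Variables (R : realFieldType) (V : finType).
Implicit Types (E H T P : {set {set V}}) (w l : {set V} -> R) (u v : V).
Implicit Types (K : {set V * V}) (delta : V -> V -> \bar R) (tb : tie_breaking V).

Definition total_weight w E : R := \sum_(e in E) w e.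

(* The distance is +oo if u and v are not connected. *)
Definition dist E l u v : \bar R :=
  \big[mine/+oo%E]_(P | is_path E u v P) (total_weight l P)%:E.

Definition is_shortest_path E l u v P : bool :=
  is_path E u v P && ((total_weight l P)%:E == dist E l u v).

(* The default set0 is only reached if there is no path from u to v. *)
Definition shortest_path E l tb u v : {set {set V}} :=
  extremum (path_le tb) set0 (is_shortest_path E l u v) id.

(* The default E is only reached if E has no spanning tree. *)
Definition mst E w : {set {set V}} :=
  [arg min_(T < E | spanning_tree E T) total_weight w T]%O.

Definition processing_order E l tb : rel (V * V) := fun p q =>
  (dist E l p.1 p.2 < dist E l q.1 q.2)%E ||
  ((dist E l p.1 p.2 == dist E l q.1 q.2) && pair_le tb p q).

Definition greedy_step E l delta tb H (p : V * V) : {set {set V}} :=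
  if (delta p.1 p.2 < dist H l p.1 p.2)%E
  then H :|: shortest_path E l tb p.1 p.2 else H.

Definition greedy E K l delta tb : {set {set V}} :=
  foldl (greedy_step E l delta tb) set0
        (sort (processing_order E l tb) (enum K)).

Definition feasible K l delta H : bool :=
  [forall p in K, (dist H l p.1 p.2 <= delta p.1 p.2)%E].

Definition restrict_weight E w (x : \bar R) : {set {set V}} :=
  [set e in E | ((w e)%:E <= x)%E].

(* For a graph without edges the minimum is taken to be +oo. *)
Definition min_feasible_weight E K w l delta : \bar R :=
  \big[mine/+oo%E]_(e in E | feasible K l delta (restrict_weight E w (w e)%:E))
    (w e)%:E.

Definition weight_threshold E K w l delta : \bar R :=
  maxe (min_feasible_weight E K w l delta) (total_weight w (mst E w))%:E.

Definition augmented_greedy E K w l delta tb : {set {set V}} :=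
  greedy (restrict_weight E w (weight_threshold E K w l delta)) K l delta tb.

Definition metric_edge E l u v : bool :=
  ([set u; v] \in E) && ((l [set u; v])%:E < dist (E :\ [set u; v]) l u v)%E.

(* Every metric edge {u, v} is listed once, as the pair (u, v) with u before v in
   the enumeration of V. *)
Definition metric_pairs E l : {set V * V} :=
  [set p | (enum_rank p.1 < enum_rank p.2)%N && metric_edge E l p.1 p.2].

Definition mult_demand E l (alpha : R) u v : \bar R := (alpha%:E * dist E l u v)%E.

(* If V is a single vertex, this is 0 / 0 = 0. *)
Definition lightness E w H : R := total_weight w H / total_weight w (mst E w).

End Algorithms.

(* inst_w is both the weight and the length of an edge; its values outside
   inst_E are irrelevant. *)
Record instance (R : realFieldType) := Instance {
  inst_V : finType;
  inst_E : {set {set inst_V}};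
  inst_w : {set inst_V} -> R;
  inst_nonempty : (0 < #|inst_V|)%N;
  inst_simple : simple_graph inst_E;
  inst_connected : connected_graph inst_E;
  inst_positive : forall e, e \in inst_E -> 0 < inst_w e
}.

Arguments inst_w {R} _ _.

Section Spanners.
Variables (R : realFieldType) (alpha : R) (I : instance R).
Variable tb : tie_breaking (inst_V I).

Definition greedy_spanner : {set {set inst_V I}} :=
  greedy (inst_E I) (metric_pairs (inst_E I) (inst_w I)) (inst_w I)
    (mult_demand (inst_E I) (inst_w I) alpha) tb.

Definition augmented_greedy_spanner : {set {set inst_V I}} :=
  augmented_greedy (inst_E I) (metric_pairs (inst_E I) (inst_w I))
    (inst_w I) (inst_w I) (mult_demand (inst_E I) (inst_w I) alpha) tb.

Definition inst_lightness (H : {set {set inst_V I}}) : R :=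
  lightness (inst_E I) (inst_w I) H.

End Spanners.

(* Main.v *)
(* The augmented greedy algorithm returns exactly the greedy spanner. Any two
   nodes are joined by a path inside a minimum spanning tree, so every shortest
   path has length at most w(MST); as weights equal lengths, each of its edges
   has weight at most w(MST) and survives in the pruned graph. Hence pruning
   changes neither the distances nor the shortest paths, which are all that the
   greedy algorithm reads off its input graph. *)

Require Import Defs.
From HB Require Import structures.
From mathcomp Require Import all_boot all_order all_algebra.
From mathcomp Require Import constructive_ereal.
From Stdlib Require Import FunctionalExtensionality.

Set Implicit Arguments.
Unset Strict Implicit.
Unset Printing Implicit Defensive.

Import Order.TTheory GRing.Theory Num.Theory.

Local Open Scope ring_scope.

Section Paths.
Variable V : finType.
Implicit Types (E T P : {set {set V}}) (u v : V) (p : seq V).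

(** This makes being a path depend on the graph only through inclusion of the edge set, so paths
    transfer between a graph and its pruned version. *)
Lemma path_adjE E u p : path (adj E) u p = (path_edges u p \subset E).
Proof.
rewrite /path_edges; elim: p u => [|x p IHp] u /=.
  by apply/esym/subsetP => e; rewrite inE.
rewrite IHp; apply/andP/subsetP => [[uxE /subsetP pE] e | pE].
  by rewrite !inE => /predU1P[-> // | ep]; apply: pE; rewrite inE.
split; first by apply: pE; rewrite !inE eqxx.
by apply/subsetP => e; rewrite inE => ep; apply: pE; rewrite !inE ep orbT.
Qed.

Lemma is_path_sub E u v P : is_path E u v P -> P \subset E.
Proof. by case/existsP => p /and4P[+ _ _ /eqP->]; rewrite path_adjE. Qed.

Lemma is_pathW E T u v P : P \subset T -> is_path E u v P -> is_path T u v P.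
Proof.
move=> PT /existsP[p /and4P[_ lp up /eqP PE]]; apply/existsP; exists p.
by rewrite lp up PE path_adjE -PE PT eqxx.
Qed.

Lemma connected_is_path E u v :
  connected_graph E -> exists P, is_path E u v P.
Proof.
move=> /forallP/(_ u)/forallP/(_ v)/connectP[p0 Ep0 ->].
case/shortenP: Ep0 => p Ep up _.
(* [is_path] only ranges over sequences of size at most [#|V|]; the shortened walk fits because
   [u :: p] repeats no vertex. *)
have sp : (size p <= #|V|)%N.
  by apply: ltnW; have /card_uniqP /= <- := up; apply: max_card.
exists (path_edges u p); apply/existsP; exists (Bseq sp).
by apply/and4P; split.
Qed.

End Paths.

Section Distances.
Variables (R : realFieldType) (V : finType) (l : {set V} -> R).
Implicit Types (E T P : {set {set V}}) (u v : V).

Lemma ler_total_weight E T :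
  {in T, forall e, 0 <= l e} -> E \subset T ->
  total_weight l E <= total_weight l T.
Proof.
move=> l_ge0 ET; rewrite /total_weight [leRHS](big_setID E) /=.
rewrite (setIidPr ET) lerDl sumr_ge0 // => e.
by rewrite inE => /andP[_ /l_ge0].
Qed.

Lemma dist_le_weight E u v P :
  is_path E u v P -> (dist E l u v <= (total_weight l P)%:E)%E.
Proof. exact: bigmin_le_cond. Qed.

(** Either the arg min is a genuine spanning tree or it is the default [E], and the claim holds in
    both cases. The same split proves [mst_connected]. *)
Lemma mst_sub E : mst E l \subset E.
Proof.
by rewrite /mst /Order.arg_min /extremum; case: pickP => //= T /andP[/and3P[]].
Qed.

Lemma mst_connected E : connected_graph E -> connected_graph (mst E l).
Proof.
by rewrite /mst /Order.arg_min /extremum; case: pickP => //= T /andP[/and3P[]].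
Qed.

Section Pruning.
Variables (E : {set {set V}}) (x : \bar R).
Hypothesis E_connected : connected_graph E.
Hypothesis l_ge0 : {in E, forall e, 0 <= l e}.
Hypothesis mst_le_x : ((total_weight l (mst E l))%:E <= x)%E.

Let E' := restrict_weight E l x.

Lemma restrict_weight_sub P :
  P \subset E -> ((total_weight l P)%:E <= x)%E -> P \subset E'.
Proof.
move=> PE Px; apply/subsetP => e eP; rewrite inE (subsetP PE) //=.
apply: le_trans Px; rewrite lee_fin.
(* Viewed as a one-edge subset of [P], the edge is bounded by monotonicity of total weight. *)
suff -> : l e = total_weight l [set e].
  by apply: ler_total_weight; rewrite ?sub1set // => f /(subsetP PE)/l_ge0.
by rewrite /total_weight big_set1.
Qed.

Lemma is_path_restrict_weight u v P :
  is_path E' u v P -> is_path E u v P.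
Proof.
move=> uvP; apply: is_pathW (uvP); apply: subset_trans (is_path_sub uvP) _.
by apply/subsetP => e; rewrite inE => /andP[].
Qed.

Lemma short_path_restrict_weight u v P :
  ((total_weight l P)%:E <= x)%E -> is_path E' u v P = is_path E u v P.
Proof.
move=> Px; apply/idP/idP => [|uvP]; first exact: is_path_restrict_weight.
by apply: is_pathW (uvP); apply: restrict_weight_sub Px; apply: is_path_sub uvP.
Qed.

Lemma dist_restrict_weight_le u v : (dist E' l u v <= x)%E.
Proof.
(* The witness runs inside the minimum spanning tree. Its edges form a subset of the tree, so its
   length is at most the tree's weight, hence at most [x]. *)
have [P uvP] := connected_is_path u v (mst_connected E_connected).
have PT := is_path_sub uvP.
have Px : ((total_weight l P)%:E <= x)%E.
  apply: le_trans mst_le_x; rewrite lee_fin; apply: ler_total_weight => // e.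
  by move=> /(subsetP (mst_sub E))/l_ge0.
apply: le_trans (Px); apply: dist_le_weight.
rewrite short_path_restrict_weight //.
by apply: is_pathW uvP; apply: subset_trans PT (mst_sub E).
Qed.

(** An equality of functions, so that it rewrites under the binders of [processing_order]. *)
Lemma dist_restrict_weight : dist E' l = dist E l.
Proof.
apply: functional_extensionality => u; apply: functional_extensionality => v.
apply/le_anti/andP; split; apply: le_bigmin => [|P uvP]; rewrite ?leey //.
  (* A path of length at most [x] survives pruning. A longer one may be lost, but the pruned
     distance is at most [x] anyway. *)
  have [Px | /ltW xP] := leP (total_weight l P)%:E x.
    by apply: dist_le_weight; rewrite short_path_restrict_weight.
  exact: le_trans (dist_restrict_weight_le u v) xP.
by apply: dist_le_weight; apply: is_path_restrict_weight.
Qed.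

Lemma shortest_path_restrict_weight tb :
  shortest_path E' l tb = shortest_path E l tb.
Proof.
apply: functional_extensionality => u; apply: functional_extensionality => v.
suff eq_short : is_shortest_path E' l u v = is_shortest_path E l u v.
  by rewrite /shortest_path eq_short.
apply: functional_extensionality => P.
rewrite /is_shortest_path dist_restrict_weight.
(* Only sets whose weight is the distance matter, and that distance is at most [x]. So both graphs
   offer the tie-breaking rule the same candidates. *)
have [PE | //] := eqVneq (total_weight l P)%:E (dist E l u v);
  last by rewrite !andbF.
rewrite short_path_restrict_weight // PE -dist_restrict_weight.
exact: dist_restrict_weight_le.
Qed.

Lemma greedy_restrict_weight K delta tb :
  greedy E' K l delta tb = greedy E K l delta tb.
Proof.
rewrite /greedy /greedy_step /processing_order.
by rewrite dist_restrict_weight shortest_path_restrict_weight.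
Qed.

End Pruning.
End Distances.

Lemma augmented_greedy_spannerE (R : realFieldType) (alpha : R)
    (I : instance R) (tb : tie_breaking (inst_V I)) :
  augmented_greedy_spanner alpha tb = greedy_spanner alpha tb.
Proof.
(* Coupling enters here: pruning by weight is pruning by length. *)
apply: greedy_restrict_weight; first exact: inst_connected.
  by move=> e /inst_positive/ltW.
(* The threshold is a maximum with the tree's weight as one argument. *)
by rewrite /weight_threshold le_max lexx orbT.
Qed.

Theorem lemma6 (R : realFieldType) (alpha : R) (halpha : 1 <= alpha)
    (tb : forall I : instance R, tie_breaking (inst_V I))
    (C : instance R -> Prop) (g : nat -> R -> R) :
  ((forall I : instance R, C I ->
      (#|greedy_spanner alpha (tb I)|)%:R <= g #|inst_V I| alpha) ->
   (forall I : instance R, C I ->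
      (#|augmented_greedy_spanner alpha (tb I)|)%:R <= g #|inst_V I| alpha))
  /\
  ((forall I : instance R, C I ->
      inst_lightness (greedy_spanner alpha (tb I)) <= g #|inst_V I| alpha) ->
   (forall I : instance R, C I ->
      inst_lightness (augmented_greedy_spanner alpha (tb I))
        <= g #|inst_V I| alpha)).
Proof.
by split=> greedy_le I CI; rewrite augmented_greedy_spannerE; apply: greedy_le.
Qed.
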